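(* Let $\mathbf{f}=(f_1,f_2,f_3):\mathbb{R}^3\to\mathbb{R}^3$ and $g:\mathbb{R}^3\to\mathbb{R}$ be continuously differentiable. Consider the problem of minimizing $\int_0^1(u_1^2+u_2^2+u_3^2)\,dt$ over the trajectories of the system with drift $$\dot{x}_1=u_1,\quad \dot{x}_2=u_2,\quad \dot{x}_3=u_3,\quad \dot{x}_4=g(x_1,x_2,x_3)+\sum_{k=1}^{3}f_k(x_1,x_2,x_3)u_k,$$ and the associated augmented Lagrangian $$L=\dot{x}_1^2+\dot{x}_2^2+\dot{x}_3^2+\lambda\bigl(\dot{x}_4-g-f_1\dot{x}_1-f_2\dot{x}_2-f_3\dot{x}_3\bigr).$$ If $(x_1,x_2,x_3,x_4,\lambda)$ satisfies the Euler-Lagrange equations of $L$, then $\lambda$ is constant and, writing $\mathbf{x}=(x_1,x_2,x_3)$, there is a constant $\mu\in\mathbb{R}$ (namely $\mu=\lambda/2$) such that $$\ddot{\mathbf{x}}=-\mu\nabla g+\mu\,(\nabla\times\mathbf{f})\times\dot{\mathbf{x}},$$ i.e. $\mathbf{x}$ satisfies the equation of motion of a charged particle in an electromagnetic field.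
   Context: The functions $x_1,x_2,x_3,x_4$ of $t\in[0,1]$ are twice continuously differentiable and $\lambda$ is a continuously differentiable function of $t$; the Euler-Lagrange equations of $L$ are taken with respect to all of $x_1,x_2,x_3,x_4,\lambda$. In $L$, the functions $g,f_1,f_2,f_3$ are evaluated at $(x_1,x_2,x_3)$. $\nabla g$ is the gradient, $\nabla\times\mathbf{f}$ the usual curl on $\mathbb{R}^3$, both evaluated along $\mathbf{x}(t)$, and $\times$ between vectors is the cross product. *)

(* Defs.v *)
From HB Require Import structures.
From mathcomp Require Import all_boot all_order all_algebra.
From mathcomp Require Import all_classical all_reals all_analysis.
Set Implicit Arguments.
Unset Strict Implicit.
Unset Printing Implicit Defensive.
Import Order.TTheory GRing.Theory Num.Theory numFieldNormedType.Exports.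
Local Open Scope classical_set_scope.
Local Open Scope ring_scope.

Section Derivatives.
Context {R : realType}.

(* Continuous differentiability of a map between normed spaces. Asking for
   p |-> dF_p(v) to be continuous for each v is continuity of the differential
   in the strong operator topology; on a finite-dimensional V, the only case
   used here, that is continuity in operator norm. *)
Definition C1 {V W : normedModType R} (F : V -> W) : Prop :=
  (forall p, differentiable F p) /\
  (forall v, continuous (fun p => 'd F p v)).

Definition partial {n : nat} {W : normedModType R} (i : 'I_n)
  (F : 'rV[R]_n -> W) (p : 'rV[R]_n) : W := 'D_(delta_mx 0 i) F p.

(* Derivatives relative to a set A of times: the increments h are restricted
   to t + h \in A, so that on A = [0, 1] the derivatives at the two endpoints
   are one-sided, and values outside A are irrelevant. *)
Definition quotient_on {V : normedModType R} (A : set R) (c : R -> V) (t : R) :=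
  (fun h => h^-1 *: (c (t + h) - c t)) @ within [set h | A (t + h)] 0^'.

Definition derivable_on {V : normedModType R} (A : set R) (c : R -> V) (t : R)
  : Prop := cvg (quotient_on A c t).

Definition derive_on {V : normedModType R} (A : set R) (c : R -> V) (t : R)
  : V := lim (quotient_on A c t).

Definition C1_on {V : normedModType R} (A : set R) (c : R -> V) : Prop :=
  (forall t, A t -> derivable_on A c t) /\
  {within A, continuous (derive_on A c)}.

Definition C2_on {V : normedModType R} (A : set R) (c : R -> V) : Prop :=
  C1_on A c /\ C1_on A (derive_on A c).

(* d/dt (dL/dv_i (q, q')) = dL/dq_i (q, q') for every coordinate i and every
   time in A; the derivative on the left is required to exist. *)
Definition Euler_Lagrange {n : nat} (L : 'rV[R]_n -> 'rV[R]_n -> R)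
  (A : set R) (q : R -> 'rV[R]_n) : Prop :=
  let v := derive_on A q in
  forall t, A t -> forall i : 'I_n,
    let momentum := fun s => partial i (L (q s)) (v s) in
    derivable_on A momentum t /\
    derive_on A momentum t = partial i (fun y => L y (v t)) (q t).

End Derivatives.

Section VectorCalculus.
Context {R : realType}.

(* The numerals indexing 'I_3 and 'I_5 below are ring constants of those types,
   whose underlying naturals are the expected ones: x_k has index k - 1. *)

Definition row3 (a b c : R) : 'rV[R]_3 := \row_(i < 3) [:: a; b; c]`_i.

Definition row5 (a b c d e : R) : 'rV[R]_5 :=
  \row_(i < 5) [:: a; b; c; d; e]`_i.

Definition cross (u v : 'rV[R]_3) : 'rV[R]_3 :=
  row3 (u 0 1 * v 0 2 - u 0 2 * v 0 1)
       (u 0 2 * v 0 0 - u 0 0 * v 0 2)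
       (u 0 0 * v 0 1 - u 0 1 * v 0 0).

Definition grad (g : 'rV[R]_3 -> R) (p : 'rV[R]_3) : 'rV[R]_3 :=
  \row_i partial i g p.

Definition curl (f : 'rV[R]_3 -> 'rV[R]_3) (p : 'rV[R]_3) : 'rV[R]_3 :=
  let d (i k : 'I_3) := partial i (fun y => f y 0 k) p in
  row3 (d 1 2 - d 2 1) (d 2 0 - d 0 2) (d 0 1 - d 1 0).

End VectorCalculus.

Section Lagrangian.
Context {R : realType}.

(* The augmented Lagrangian of minimizing the integral of
   u_1^2 + u_2^2 + u_3^2 along x_k' = u_k (k = 1, 2, 3),
   x_4' = g + \sum_k f_k u_k, with the controls eliminated.
   The configuration is q = (x_1, x_2, x_3, x_4, lambda), v is its velocity. *)
Definition augmented_Lagrangian (f : 'rV[R]_3 -> 'rV[R]_3) (g : 'rV[R]_3 -> R)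
  (q v : 'rV[R]_5) : R :=
  let x := row3 (q 0 0) (q 0 1) (q 0 2) in
  let lambda := q 0 4 in
  v 0 0 ^+ 2 + v 0 1 ^+ 2 + v 0 2 ^+ 2
  + lambda * (v 0 3 - g x - f x 0 0 * v 0 0 - f x 0 1 * v 0 1
                          - f x 0 2 * v 0 2).

End Lagrangian.

(* Main.v *)
Require Import Defs.
From HB Require Import structures.
From mathcomp Require Import all_boot all_order all_algebra.
From mathcomp Require Import all_classical all_reals all_analysis.
From mathcomp Require Import ring.
Import Order.TTheory GRing.Theory Num.Theory numFieldNormedType.Exports.
Local Open Scope classical_set_scope.
Local Open Scope ring_scope.

(** Write x_k (k = 1, 2, 3) for the spatial coordinates and l for the multiplier.
An Euler-Lagrange equation is made explicit by computing two partial derivatives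
of L.

- Along x_4: the momentum is l, and L does not depend on the position x_4, so
  l has zero derivative on [0, 1]; by the mean value theorem it is constant
  ([partial_velocity_x4], [partial_position_x4], [has_derivative_on_itv_cst]).

- Along x_k: the momentum is 2 x_k' - l f_k(x), and the partial derivative of L
  in the position x_k is - l (d_k g + sum_j (d_k f_j) x_j')
  ([partial_velocity_space], [partial_position_space]).  As l is constant, the
  chain rule ([has_derivative_on_comp], [diff_partial]) turns the equation into

    2 x_k'' = - l d_k g + l sum_j (d_j f_k - d_k f_j) x_j',

  and the last sum is the k-th coordinate of the cross product of curl f(x) with
  x' ([cross_curlE]).

Since curves are differentiated relative to [0, 1], with one-sided derivatives
at the endpoints, the calculus rules for curves are established for derivatives
relative to a set of times.  Such a derivative is unique because the filter of
admissible increments is proper ([increments_itv_proper]). *)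

Set Implicit Arguments.
Unset Strict Implicit.
Unset Printing Implicit Defensive.

(** * Derivatives of curves relative to a set of times *)

Section DerivativeOn.
Context {R : realType}.

Lemma cvg_sumr {T I : Type} {V : normedModType R} {F : set_system T}
  {FF : Filter F} (r : seq I) (c : I -> T -> V) (a : I -> V) :
  (forall i, c i x @[x --> F] --> a i) ->
  \sum_(i <- r) c i x @[x --> F] --> \sum_(i <- r) a i.
Proof.
move=> ca; elim: r => [|i r IHr].
  rewrite big_nil; under eq_fun do rewrite big_nil; exact: cvg_cst.
by rewrite big_cons; under eq_fun do rewrite big_cons; apply: cvgD.
Qed.

Definition increments (A : set R) (t : R) : set_system R :=
  within [set h | A (t + h)] 0^'.

(** The value of the derivative is part of the predicate: unlike an equation on
[derive_on], a total limit operator, it also carries the existence of the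
limit. *)
Definition has_derivative_on {V : normedModType R} (A : set R) (c : R -> V)
  (t : R) (d : V) : Prop :=
  h^-1 *: (c (t + h) - c t) @[h --> increments A t] --> d.

Instance increments_filter (A : set R) (t : R) : Filter (increments A t).
Proof. exact: within_filter. Qed.

Lemma increments_to_0 (A : set R) (t : R) : h @[h --> increments A t] --> (0 : R).
Proof. by apply: cvg_within_filter; apply: cvg_within. Qed.

Lemma increments_neq0 (A : set R) (t : R) : \forall h \near increments A t, h != 0.
Proof. exact: cvg_within (nbhs_dnbhs_neq (0 : R)). Qed.

Section OneCurve.
Context {V : normedModType R} {A : set R}.

Lemma derivable_onP (c : R -> V) t :
  derivable_on A c t -> has_derivative_on A c t (derive_on A c t).
Proof. by []. Qed.

Lemma derive_onE (c : R -> V) t d : ProperFilter (increments A t) ->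
  has_derivative_on A c t d -> derive_on A c t = d.
Proof. by move=> At cd; apply: cvg_lim => //; exact: norm_hausdorff. Qed.

Lemma has_derivative_on_congr (c c' : R -> V) t d : A t -> {in A, c =1 c'} ->
  has_derivative_on A c t d -> has_derivative_on A c' t d.
Proof.
move=> At cc'; apply: cvg_trans; apply: fmap_within_eq => h.
by rewrite inE /= => Ath; rewrite !cc' ?inE.
Qed.

(** The increment of the curve is h times the difference quotient, the product
of a quantity tending to 0 and a convergent one. *)
Lemma has_derivative_on_increment (c : R -> V) t d : has_derivative_on A c t d ->
  c (t + h) - c t @[h --> increments A t] --> (0 : V).
Proof.
move=> cd; have := cvgZ (FF := increments_filter A t) (@increments_to_0 A t) cd.
rewrite scale0r; apply: cvg_trans; apply: near_eq_cvg.
have := @increments_neq0 A t; apply: filterS => h h0 /=.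
by rewrite scalerA mulfV ?scale1r.
Qed.

Lemma derivable_on_continuous (c : R -> V) :
  (forall t, A t -> derivable_on A c t) -> {within A, continuous c}.
Proof.
move=> cA; apply/subspace_continuousP => t At.
have /cvgr0Pnorm_le c0 := has_derivative_on_increment (derivable_onP (cA t At)).
apply/cvgrPdist_le => e e0; rewrite near_withinE.
apply/(nbhs0P (fun y => A y -> `|c t - c y| <= e)).
have near0 : \forall h \near (0 : R),
  h != 0 -> A (t + h) -> `|c (t + h) - c t| <= e := c0 e e0.
apply: filterS near0 => h ch Ath; have [->|h0] := eqVneq h 0.
  by rewrite addr0 subrr normr0 ltW.
by rewrite distrC; exact: ch.
Qed.

(** Chain rule.  With D the increment of c and k the remainder of F at c t, the
difference quotient of F o c is the differential of F at D / h, which converges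
by continuity, plus k(D) / h, which is o(D) / h and vanishes because D / h is
bounded. *)
Lemma has_derivative_on_comp {W : normedModType R} (F : V -> W) (c : R -> V)
  t d : differentiable F (c t) -> has_derivative_on A c t d ->
  has_derivative_on A (F \o c) t ('d F (c t) d).
Proof.
move=> dF cd; have c0 := has_derivative_on_increment cd.
pose k u := F (u + c t) - F (c t) - 'd F (c t) u.
rewrite /has_derivative_on.
have -> : (fun h => h^-1 *: ((F \o c) (t + h) - (F \o c) t)) =
    (fun h => 'd F (c t) (h^-1 *: (c (t + h) - c t)) +
              h^-1 *: k (c (t + h) - c t)).
  by apply/funext => h; rewrite linearZ_LR -scalerDr /k subrK subrKC.
rewrite -[X in _ --> X]addr0; apply: cvgD.
  by apply: continuous_cvg cd; exact: diff_continuous.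
apply/cvgr0Pnorm_le => e e0; have M0 : 0 < `|d| + 1 by rewrite ltr_wpDl.
(* |D / h| is eventually below |d| + 1, so this bound gives |k(D) / h| <= e. *)
have kM : \forall u \near 0, `|k u| <= e / (`|d| + 1) * `|u|.
  have /eqaddoP/(_ _ (divr_gt0 e0 M0)) := diff_locally dF.
  by apply: filterS => u; rewrite /= !fctE /= /k opprD addrA.
near=> h; rewrite normrZ.
apply: (@le_trans _ _ (`|h^-1| * (e / (`|d| + 1) * `|c (t + h) - c t|))).
  by rewrite ler_wpM2l //; near: h; exact: (c0 _ kM).
rewrite mulrCA -normrZ mulrAC ler_pdivrMr // ler_wpM2l ?ltW //.
by near: h; apply: cvgr_norm_lt cd _ _; rewrite ltrDl.
Unshelve. all: by end_near. Qed.

End OneCurve.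

Lemma has_derivative_onD {V : normedModType R} (A : set R) (b c : R -> V) t db dc :
  has_derivative_on A b t db -> has_derivative_on A c t dc ->
  has_derivative_on A (fun s => b s + c s) t (db + dc).
Proof.
move=> hb hc; rewrite /has_derivative_on.
under eq_fun do rewrite opprD addrACA scalerDr.
exact: cvgD.
Qed.

Lemma has_derivative_onZ {V : normedModType R} (A : set R) (c : R -> V) t dc k :
  has_derivative_on A c t dc -> has_derivative_on A (fun s => k *: c s) t (k *: dc).
Proof.
move=> hc; rewrite /has_derivative_on.
under eq_fun do rewrite -scalerBr scalerA mulrC -scalerA.
exact: cvgZl_tmp.
Qed.

(** A row is the linear combination of the basis rows with its coordinates as
coefficients, so coordinatewise limits add up. *)
Lemma has_derivative_on_row n (A : set R) (c : 'I_n -> R -> R) t (d : 'I_n -> R) :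
  (forall i, has_derivative_on A (c i) t (d i)) ->
  has_derivative_on A (fun s => \row_i c i s) t (\row_i d i).
Proof.
move=> cd.
have rowE (a : 'I_n -> R) : \row_i a i = \sum_i a i *: delta_mx (0 : 'I_1) i.
  by rewrite [LHS]row_sum_delta; apply: eq_bigr => i _; rewrite mxE.
rewrite /has_derivative_on (rowE d).
have -> : (fun h => h^-1 *: (\row_i c i (t + h) - \row_i c i t)) =
  (fun h => \sum_i (h^-1 *: (c i (t + h) - c i t)) *: delta_mx (0 : 'I_1) i).
  apply/funext => h; rewrite -rowE; apply/rowP => i; by rewrite !mxE.
apply: cvg_sumr => i; apply: cvgZr_tmp; exact: cd.
Qed.

(** Arbitrarily small nonzero increments stay in [a, b]: positive ones for
t < b, negative ones for t = b. *)
Lemma increments_itv_proper (a b t : R) : a < b -> t \in `[a, b] ->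
  ProperFilter (increments `[a, b] t).
Proof.
move=> ab; rewrite in_itv /= => /andP[at_ tb].
apply: Build_ProperFilter; rewrite /increments /within /dnbhs /=.
move=> /nbhs_ballP[e /= e0 He].
have [tb'|tb'] := ltP t b.
  pose h := Num.min (e / 2) (b - t).
  have h0 : 0 < h by rewrite lt_min divr_gt0 //= subr_gt0.
  apply: (He h); rewrite ?gt_eqF //=.
    rewrite /ball /= sub0r normrN gtr0_norm // gt_min; apply/orP; left.
    by rewrite ltr_pdivrMr // ltr_pMr // ltr1n.
  rewrite in_itv /= (le_trans at_) ?lerDl ?(ltW h0) //=.
  by rewrite addrC -lerBrDr /h ge_min lexx orbT.
have {tb'}tb : t = b by apply/eqP; rewrite eq_le tb.
rewrite {t at_}tb in He.
pose h := Num.min (e / 2) (b - a).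
have h0 : 0 < h by rewrite lt_min divr_gt0 //= subr_gt0.
apply: (He (- h)); rewrite ?oppr_eq0 ?gt_eqF //=.
  rewrite /ball /= sub0r opprK gtr0_norm // gt_min; apply/orP; left.
  by rewrite ltr_pdivrMr // ltr_pMr // ltr1n.
rewrite in_itv /= gerBl (ltW h0) andbT lerBrDr addrC -lerBrDr.
by rewrite /h ge_min lexx orbT.
Qed.

Lemma has_derivative_on_interior (A : set R) (c : R -> R) t d : nbhs t A ->
  has_derivative_on A c t d -> is_derive t 1 c d.
Proof.
move=> /nbhs0P nA cd.
have cvd : h^-1 *: ((c \o shift t) (h *: 1) - c t) @[h --> 0^'] --> d.
  move=> U /cd; rewrite /increments /= /within /= => nU.
  rewrite nbhs_filterE /=.
  have nA' : \forall h \near (0 : R)^', A (t + h) by apply: cvg_within.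
  rewrite /fmap /=; near=> h.
  have Ath : A (t + h) by near: h.
  rewrite /= [h *: _]mulr1 [h + t]addrC; move: Ath; near: h; exact: nU.
apply: DeriveDef; first by apply/cvg_ex; exists d.
by apply: cvg_lim => //; exact: norm_hausdorff.
Unshelve. all: by end_near. Qed.

(** Relative derivatives are ordinary ones in the interior and imply continuity
up to the endpoints: these are the hypotheses of the mean value theorem. *)
Lemma has_derivative_on_itv_cst (a b : R) (c : R -> R) :
  (forall t, t \in `[a, b] -> has_derivative_on `[a, b] c t 0) ->
  {in `[a, b], forall t, c t = c a}.
Proof.
move=> c0 t; rewrite in_itv /= => /andP[at_ tb].
move: at_; rewrite le_eqVlt => /predU1P[<-//|at_].
have cc : {within `[a, b], continuous c}.
  by apply: derivable_on_continuous => s sab; apply/cvg_ex; exists 0; exact: c0.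
have dc s : s \in `]a, t[ -> is_derive s 1 c 0.
  rewrite in_itv /= => /andP[as_ st].
  have nA : nbhs s [set` `[a, b]].
    have : s \in `]a, b[ by rewrite in_itv /= as_ (lt_le_trans st).
    by move=> /near_in_itvoo; apply: filterS => y; exact: subset_itv_oo_cc.
  apply: (has_derivative_on_interior nA); apply: c0; exact: (nbhs_singleton nA).
have ct : {within `[a, t], continuous c}.
  by apply: continuous_subspaceW cc; apply: subset_itvl; rewrite bnd_simp.
have [s _] := MVT at_ dc ct.
by rewrite mul0r => /eqP; rewrite subr_eq0 => /eqP.
Qed.

End DerivativeOn.

(** * Partial derivatives and vector identities *)

Lemma ord3_ind (P : 'I_3 -> Prop) : P 0 -> P 1 -> P 2 -> forall k, P k.
Proof.
by move=> P0 P1 P2 [[|[|[|k]]] k3] //;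
  [move: P0|move: P1|move: P2]; congr (P _); exact/val_inj.
Qed.

Lemma ord5_ind (P : 'I_5 -> Prop) :
  P 0 -> P 1 -> P 2 -> P 3 -> P 4 -> forall k, P k.
Proof.
by move=> P0 P1 P2 P3 P4 [[|[|[|[|[|k]]]]] k5] //;
  [move: P0|move: P1|move: P2|move: P3|move: P4]; congr (P _); exact/val_inj.
Qed.

Section VectorIdentities.
Context {R : realType}.

(** The curl encodes the antisymmetric part of the Jacobian of f: applying this
part to v is the cross product with the curl.  The diagonal terms vanish. *)
Lemma cross_curlE (f : 'rV[R]_3 -> 'rV[R]_3) (p v : 'rV[R]_3) (k : 'I_3) :
  cross (curl f p) v 0 k =
  \sum_j (partial j (fun y => f y 0 k) p - partial k (fun y => f y 0 j) p)
         * v 0 j.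
Proof.
rewrite /cross /curl !big_ord_recl big_ord0 /row3 !mxE /=.
have -> : lift ord0 ord0 = 1 :> 'I_3 by apply/val_inj.
have -> : lift ord0 (lift ord0 ord0) = 2 :> 'I_3 by apply/val_inj.
have -> : ord0 = 0 :> 'I_3 by apply/val_inj.
elim/ord3_ind: k => /=; ring.
Qed.

Lemma partialE n {W : normedModType R} (i : 'I_n) (F : 'rV[R]_n -> W) p (d : W) :
  h^-1 *: (F (h *: delta_mx 0 i + p) - F p) @[h --> 0^'] --> d ->
  partial i F p = d.
Proof. by move=> Fd; apply: cvg_lim => //; exact: norm_hausdorff. Qed.

Lemma differentiable_cvg_partial n {W : normedModType R} (i : 'I_n)
  (F : 'rV[R]_n -> W) p : differentiable F p ->
  h^-1 *: (F (h *: delta_mx 0 i + p) - F p) @[h --> 0^'] --> partial i F p.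
Proof. by exact: diff_derivable. Qed.

Lemma diff_partial n {W : normedModType R} (F : 'rV[R]_n -> W) p v :
  differentiable F p -> 'd F p v = \sum_j v 0 j *: partial j F p.
Proof.
move=> dF; rewrite [in LHS](row_sum_delta v) linear_sum; apply: eq_bigr => j _.
by rewrite linearZ_LR /partial deriveE.
Qed.

(** Covers every partial derivative of L that does not differentiate f or g: in
these directions L is polynomial of degree at most 2. *)
Lemma partial_quadratic n (i : 'I_n) (F : 'rV[R]_n -> R) p a b :
  (forall h, F (h *: delta_mx 0 i + p) = F p + h * (a + h * b)) ->
  partial i F p = a.
Proof.
move=> FE; apply: partialE.
have lin : a + h * b @[h --> (0 : R)^'] --> a.
  rewrite -[X in _ --> X]addr0 -[X in _ + X](mul0r b).
  by apply: cvgD; [exact: cvg_cst|apply: cvgMr_tmp; exact: nbhs_dnbhs].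
apply: cvg_trans lin; apply: near_eq_cvg; have := nbhs_dnbhs_neq (0 : R).
by apply: filterS => h h0 /=; rewrite FE [F p + _]addrC addrK /GRing.scale /= mulKf.
Qed.

End VectorIdentities.

(** * Partial derivatives of the augmented Lagrangian *)

Section LagrangianDerivatives.
Context {R : realType}.

Definition space_index : 'I_3 -> 'I_5 := widen_ord (isT : (3 <= 5)%N).

Definition position (q : 'rV[R]_5) : 'rV[R]_3 := \row_k q 0 (space_index k).

Context (f : 'rV[R]_3 -> 'rV[R]_3) (g : 'rV[R]_3 -> R).

(** Sums over the spatial indices let the three spatial directions be treated at
once. *)
Lemma augmented_LagrangianE (q v : 'rV[R]_5) :
  augmented_Lagrangian f g q v =
  \sum_k v 0 (space_index k) ^+ 2
  + q 0 4 * (v 0 3 - g (position q)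
             - \sum_k f (position q) 0 k * v 0 (space_index k)).
Proof.
rewrite /augmented_Lagrangian.
have -> : row3 (q 0 0) (q 0 1) (q 0 2) = position q.
  apply/rowP => -[[|[|[|//]]] k3]; rewrite !mxE /=; congr (q _ _); exact/val_inj.
rewrite !big_ord_recl !big_ord0.
have -> : space_index ord0 = 0 by exact/val_inj.
have -> : space_index (lift ord0 ord0) = 1 by exact/val_inj.
have -> : space_index (lift ord0 (lift ord0 ord0)) = 2 by exact/val_inj.
have -> : lift ord0 ord0 = 1 :> 'I_3 by exact/val_inj.
have -> : lift ord0 (lift ord0 ord0) = 2 :> 'I_3 by exact/val_inj.
have -> : ord0 = 0 :> 'I_3 by exact/val_inj.
ring.
Qed.

Lemma space_shift (h : R) (k j : 'I_3) (q : 'rV[R]_5) :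
  (h *: delta_mx 0 (space_index k) + q) 0 (space_index j) =
  h * (j == k)%:R + q 0 (space_index j).
Proof. by rewrite !mxE eqxx -(inj_eq val_inj). Qed.

Lemma position_shift (h : R) (k : 'I_3) (q : 'rV[R]_5) :
  position (h *: delta_mx 0 (space_index k) + q) = h *: delta_mx 0 k + position q.
Proof. by apply/rowP => j; rewrite mxE space_shift !mxE eqxx. Qed.

Lemma space_shift_other (h : R) (k : 'I_3) (i : 'I_5) (q : 'rV[R]_5) :
  (2 < i)%N -> (h *: delta_mx 0 (space_index k) + q) 0 i = q 0 i.
Proof.
move=> i2; rewrite !mxE eqxx -(inj_eq val_inj) gtn_eqF ?mulr0 ?add0r //=.
exact: leq_trans (ltn_ord k) i2.
Qed.

Lemma partial_velocity_space (q v : 'rV[R]_5) (k : 'I_3) :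
  partial (space_index k) (augmented_Lagrangian f g q) v =
  2 * v 0 (space_index k) - q 0 4 * f (position q) 0 k.
Proof.
apply: (@partial_quadratic _ _ _ _ _ _ 1) => h.
rewrite !augmented_LagrangianE space_shift_other //.
under eq_bigr do rewrite space_shift.
under [X in _ - X]eq_bigr do rewrite space_shift.
pose F (j : 'I_3) : R := v 0 (space_index j).
have sqE : \sum_j (h * (j == k)%:R + F j) ^+ 2 =
    \sum_j F j ^+ 2 + h * (2 * F k + h).
  rewrite (bigD1 k) //= [in RHS](bigD1 k) //= eqxx mulr1.
  rewrite (eq_bigr (fun j => F j ^+ 2)) => [|j /negbTE ->].
    ring.
  by rewrite mulr0 add0r.
have linE : \sum_j f (position q) 0 j * (h * (j == k)%:R + F j) =
    \sum_j f (position q) 0 j * F j + h * f (position q) 0 k.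
  rewrite (bigD1 k) //= [in RHS](bigD1 k) //= eqxx mulr1.
  rewrite (eq_bigr (fun j => f (position q) 0 j * F j)) => [|j /negbTE ->].
    ring.
  by rewrite mulr0 add0r.
rewrite sqE linE {sqE linE}/F; ring.
Qed.

Lemma partial_velocity_x4 (q v : 'rV[R]_5) :
  partial 3 (augmented_Lagrangian f g q) v = q 0 4.
Proof.
apply: (@partial_quadratic _ _ _ _ _ _ 0) => h.
rewrite /augmented_Lagrangian !mxE /=; ring.
Qed.

Lemma partial_position_x4 (q v : 'rV[R]_5) :
  partial 3 (fun y => augmented_Lagrangian f g y v) q = 0.
Proof.
apply: (@partial_quadratic _ _ _ _ _ _ 0) => h.
by rewrite /augmented_Lagrangian !mxE /= !(mulr0, add0r, addr0).
Qed.

(** The difference quotient of L in the position x_k is a combination of those of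
g and of the f_j, with coefficients depending only on l and the velocity. *)
Lemma partial_position_space (q v : 'rV[R]_5) (k : 'I_3) :
  differentiable g (position q) ->
  (forall j, differentiable (fun y => f y 0 j) (position q)) ->
  partial (space_index k) (fun y => augmented_Lagrangian f g y v) q =
  - (q 0 4 * (partial k g (position q) +
      \sum_j partial k (fun y => f y 0 j) (position q) * v 0 (space_index j))).
Proof.
move=> dg df; apply: partialE; set p := position q.
have -> : (fun h => h^-1 *: (augmented_Lagrangian f g
      (h *: delta_mx 0 (space_index k) + q) v - augmented_Lagrangian f g q v)) =
  (fun h => - (q 0 4 * (h^-1 *: (g (h *: delta_mx 0 k + p) - g p)
    + \sum_j (h^-1 *: (f (h *: delta_mx 0 k + p) 0 j - f p 0 j))
             * v 0 (space_index j)))).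
  apply/funext => h.
  rewrite !augmented_LagrangianE space_shift_other // position_shift -/p.
  under [in RHS]eq_bigr do rewrite -scalerAl mulrBl.
  rewrite -scaler_sumr sumrB /GRing.scale /=; ring.
apply: cvgN; apply: cvgMl_tmp; apply: cvgD.
  exact: differentiable_cvg_partial.
apply: cvg_sumr => j; apply: cvgMr_tmp.
exact: (@differentiable_cvg_partial _ _ R k (fun y => f y 0 j) p (df j)).
Qed.

End LagrangianDerivatives.

(** * The equation of motion *)

Theorem mainTheorem6 (R : realType)
  (f : 'rV[R]_3 -> 'rV[R]_3) (g : 'rV[R]_3 -> R)
  (hf : C1 f) (hg : C1 g)
  (x1 x2 x3 x4 lambda : R -> R)
  (hx1 : C2_on `[0, 1] x1) (hx2 : C2_on `[0, 1] x2)
  (hx3 : C2_on `[0, 1] x3) (hx4 : C2_on `[0, 1] x4)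
  (hlambda : C1_on `[0, 1] lambda)
  (hEL : Euler_Lagrange (augmented_Lagrangian f g) `[0, 1]
           (fun t => row5 (x1 t) (x2 t) (x3 t) (x4 t) (lambda t))) :
  let x := fun t => row3 (x1 t) (x2 t) (x3 t) in
  let x' := derive_on `[0, 1] x in
  let x'' := derive_on `[0, 1] x' in
  exists l mu : R,
    [/\ forall t, t \in `[0, 1] -> lambda t = l,
        mu = l / 2
      & forall t, t \in `[0, 1] ->
          x'' t = - (mu *: grad g (x t))
                  + mu *: cross (curl f (x t)) (x' t)].
Proof.
move=> x x' x''.
have itv_proper t :
    t \in `[0, 1] -> ProperFilter (increments `[0, 1] t : set_system R).
  exact: increments_itv_proper.
pose q t := row5 (x1 t) (x2 t) (x3 t) (x4 t) (lambda t).
pose X (k : 'I_3) s := [:: x1 s; x2 s; x3 s]`_k.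
pose X' k := derive_on `[0, 1] (X k).
have hX k : C2_on `[0, 1] (X k).
  by elim/ord3_ind: k; [exact: hx1|exact: hx2|exact: hx3].
have positionE s : position (q s) = x s.
  by apply/rowP => -[[|[|[|//]]] k3]; rewrite !mxE.
have x'E s : s \in `[0, 1] -> x' s = \row_k X' k s.
  move=> s01; apply: derive_onE; first exact: itv_proper.
  apply: has_derivative_on_row => k; apply: derivable_onP.
  exact: (hX k).1.1.
have velocityE s k : s \in `[0, 1] ->
    derive_on `[0, 1] q s 0 (space_index k) = X' k s.
  move=> s01; pose Q (i : 'I_5) r := [:: x1 r; x2 r; x3 r; x4 r; lambda r]`_i.
  have QE : derive_on `[0, 1] q s = \row_i derive_on `[0, 1] (Q i) s.
    apply: derive_onE; first exact: itv_proper.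
    apply: has_derivative_on_row => i; apply: derivable_onP.
    elim/ord5_ind: i;
      [exact: hx1.1.1|exact: hx2.1.1|exact: hx3.1.1|exact: hx4.1.1
      |exact: hlambda.1].
  rewrite QE mxE /X'; congr (derive_on _ _ _).
  by apply/funext => r; elim/ord3_ind: k.
(* Euler-Lagrange equation along x_4. *)
have lambdaE : {in `[0, 1], forall t, lambda t = lambda 0}.
  apply: has_derivative_on_itv_cst => t t01.
  have [] := hEL t t01 3; rewrite partial_position_x4 -/q.
  have -> : (fun s => partial 3 (augmented_Lagrangian f g (q s))
      (derive_on `[0, 1] q s)) = lambda.
    by apply/funext => s; rewrite partial_velocity_x4 mxE.
  by move=> /derivable_onP + l0; rewrite l0.
exists (lambda 0), (lambda 0 / 2); split=> // t t01.
have df k : differentiable (fun y => f y 0 k) (x t).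
  pose coord (y : 'rV[R]_3) : R := y 0 k.
  have -> : (fun y => f y 0 k) = coord \o f by [].
  apply: differentiable_comp; first exact: (hf.1 (x t)).
  exact: differentiable_coord.
have accelE : x'' t = \row_k derive_on `[0, 1] (X' k) t.
  apply: derive_onE; first exact: itv_proper.
  apply: (@has_derivative_on_congr _ _ _ (fun s => \row_k X' k s)) => //.
    by move=> s; rewrite inE => s01; rewrite x'E.
  apply: has_derivative_on_row => k; apply: derivable_onP.
  exact: (hX k).2.1.
apply/rowP => k; rewrite accelE.
move: (cross _ _) (cross_curlE f (x t) (x' t) k) => w wE.
rewrite !mxE {w}wE.
(* Euler-Lagrange equation along x_k. *)
have [_] := hEL t t01 (space_index k); rewrite -/q.
rewrite partial_position_space; last 2 first.
- exact: hg.1.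
- by move=> j; rewrite positionE.
rewrite positionE mxE lambdaE //.
under eq_bigr do rewrite velocityE //.
have dx : has_derivative_on `[0, 1] x t (x' t).
  rewrite x'E //; apply: has_derivative_on_row => j; apply: derivable_onP.
  exact: (hX j).1.1.
have dmomentum : has_derivative_on `[0, 1]
    (fun s => partial (space_index k) (augmented_Lagrangian f g (q s))
                (derive_on `[0, 1] q s)) t
    (2 *: derive_on `[0, 1] (X' k) t
     + - lambda 0 *: 'd (fun y => f y 0 k) (x t) (x' t)).
  (* The factor l is constant on [0, 1] only, hence a congruence there. *)
  apply: (@has_derivative_on_congr _ _ _
    (fun s => 2 *: X' k s + - lambda 0 *: f (x s) 0 k)) => //.
    move=> s; rewrite inE => s01.
    rewrite partial_velocity_space velocityE // positionE mxE lambdaE //.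
    by rewrite /GRing.scale /= mulNr.
  apply: has_derivative_onD; apply: has_derivative_onZ.
    exact: derivable_onP ((hX k).2.1 t t01).
  exact: has_derivative_on_comp (df k) dx.
rewrite (derive_onE (itv_proper t t01) dmomentum) {dmomentum} diff_partial //.
rewrite x'E // /GRing.scale /=.
under [X in _ + _ * X]eq_bigr do rewrite mxE mulrC.
under [X in _ -> _ = _ + _ * X]eq_bigr do rewrite mxE mulrBl.
rewrite sumrB; set S := \sum_j _; set T := \sum_j _; set gk := partial k g _.
set a := derive_on _ _ _ => EL.
have -> : a = (2 * a) / 2 by field.
have -> : 2 * a = lambda 0 * S - lambda 0 * (gk + T) by rewrite -EL; ring.
by field.
Qed.
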